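(* Let $r,s\in(0,\infty)$ with $s>r$. Let $P$ be a Borel probability measure on $\mathbb{R}^d$ with absolutely continuous part $P^a\neq0$ and $\int\|x\|^{r+\eta}\,dP(x)<+\infty$ for some $\eta>0$. For every $n\ge1$, let $\alpha_n$ be an $L^r$-optimal $n$-quantizer for $P$. Assume that the maximal function $\psi_b$ associated with the sequence $(\alpha_n)_{n\ge1}$ satisfies $$\psi_b^{s/(d+r)}\in L^1(P)$$ for some $b\in(0,1/2)$. Then $$\sup_{n} n^{s/d}\int d(x,\alpha_n)^s\,dP(x)<+\infty.$$
   Context: $\mathbb{R}^d$ ($d\ge 1$) is equipped with an arbitrary norm $\|\cdot\|$; $d(x,A)=\inf_{a\in A}\|x-a\|$; $B(x,\rho)$ is the closed ball with center $x$ and radius $\rho$; $\lambda_d$ is Lebesgue measure. $P^a$ is the absolutely continuous part of $P$ with respect to $\lambda_d$. An $L^r$-optimal $n$-quantizer for $P$ is a nonempty set $\alpha\subset\mathbb{R}^d$ with $\mathrm{card}(\alpha)\le n$ minimizing $\int d(x,\alpha)^r\,dP(x)$ among all nonempty subsets of $\mathbb{R}^d$ of cardinality at most $n$. For a sequence $(\alpha_n)_{n\ge1}$ of finite nonempty subsets of $\mathbb{R}^d$ and $b\in(0,\infty)$, the associated maximal function $\psi_b:\mathbb{R}^d\to\mathbb{R}_+\cup\{\infty\}$ is $$\psi_b(x):=\sup_{n\ge1}\frac{\lambda_d(B(x,b\,d(x,\alpha_n)))}{P(B(x,b\,d(x,\alpha_n)))},$$ with the convention $\frac00:=0$ (and $\frac{c}{0}=+\infty$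 for $c>0$). *)

(* Defs.v *)
From HB Require Import structures.
From mathcomp Require Import all_boot all_order all_algebra.
From mathcomp Require Import all_classical all_reals all_analysis.
From mathcomp Require Import measurable_realfun.

Set Implicit Arguments.
Unset Strict Implicit.
Unset Printing Implicit Defensive.

Import Order.TTheory GRing.Theory Num.Theory.
Import numFieldNormedType.Exports.

Local Open Scope classical_set_scope.
Local Open Scope ring_scope.

(* R^d is the space 'rV[R]_d of row vectors, with its Borel sigma-algebra. The
   topology of 'rV[R]_d is the product topology, hence that of every norm. *)
Notation borel_rV R d := (g_sigma_algebraType (@open 'rV[R]_d)).

Section lebesgue_measure_rV.
Context {R : realType}.

Definition rV_cons d (p : measurableTypeR R * borel_rV R d) :
  borel_rV R d.+1 := row_mx (const_mx p.1 : 'M[R]_1) (p.2 : 'rV[R]_d).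

Definition rV_uncons d (x : borel_rV R d.+1) :
  measurableTypeR R * borel_rV R d :=
  ((x : 'rV[R]_d.+1) ord0 ord0, rsubmx (x : 'rV[R]_(1 + d))).

Lemma rV_consK d : cancel (@rV_cons d) (@rV_uncons d).
Proof.
move=> [t v]; rewrite /rV_cons /rV_uncons /= row_mxKr; congr pair.
by rewrite mxE; case: splitP => [j _|k]; rewrite ?mxE.
Qed.

Lemma rV_cons0 d (p : measurableTypeR R * borel_rV R d) :
  (rV_cons p : 'rV_d.+1) ord0 ord0 = p.1.
Proof. by rewrite -[in RHS](rV_consK p). Qed.

Lemma rV_consS d (p : measurableTypeR R * borel_rV R d) (i : 'I_d) :
  (rV_cons p : 'rV_d.+1) ord0 (lift ord0 i) = (p.2 : 'rV_d) ord0 i.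
Proof.
by rewrite mxE; case: splitP => [j|k [/val_inj->]]//; rewrite ord1.
Qed.

Let qball d (q : 'rV[rat]_d * nat) : set 'rV[R]_d :=
  ball (map_mx ratr q.1 : 'rV[R]_d) q.2.+1%:R^-1.

Lemma open_rV_bigcup d (U : set 'rV[R]_d) : open U ->
  U = \bigcup_q (if `[< qball q `<=` U >] then qball q else set0).
Proof.
move=> oU; apply/seteqP; split => x; last first.
  by move=> [q _]; case: ifPn => // /asboolP; exact.
move=> Ux.
have /nbhs_ballP[e /= e0 eU] : nbhs x U by exact: open_nbhs_nbhs.
have [n ne] : exists n, n.+1%:R^-1 < e / 2 :> R.
  have e20 : 0 < e / 2 by rewrite divr_gt0.
  exists (Num.bound (e / 2)^-1); rewrite invf_plt ?posrE//.
  rewrite (lt_le_trans (archi_boundP _))//; first by rewrite invr_ge0 ltW.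
  by rewrite ler_nat.
have n0 : 0 < n.+1%:R^-1 :> R by rewrite invr_gt0.
have ex i : exists q : rat, ball (x ord0 i) n.+1%:R^-1 (ratr q).
  have /rat_in_itvoo[q] : x ord0 i - n.+1%:R^-1 < x ord0 i + n.+1%:R^-1.
    by rewrite ltrD2l gtrN.
  rewrite in_itv/= => /andP[q1 q2]; exists q.
  by rewrite /ball/= ltr_distlC q1.
pose q : 'rV[rat]_d := \row_i projT1 (cid (ex i)).
have qx i : ball (x ord0 i) n.+1%:R^-1 (ratr (q ord0 i)).
  by rewrite mxE; case: cid.
have Bx : qball (q, n) x.
  split => //= i j; rewrite !ord1 mxE.
  exact/ball_sym/qx.
exists (q, n) => //; rewrite asboolT//.
move=> y [_ By]; apply: eU; split => // i j; rewrite [e]splitr.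
apply: (@ball_triangle _ _ (ratr (q ord0 j) : R)).
  by rewrite ord1; apply: le_ball (ltW ne) _ (qx j).
have := By i j; rewrite mxE ord1; exact/le_ball/ltW.
Qed.

Lemma measurable_rV_cons d : measurable_fun [set: _] (@rV_cons d).
Proof.
apply: (@measurability _ _ _ (borel_rV R d.+1) _ _ (@open 'rV[R]_d.+1)) => //.
move=> _ [U oU <-]; rewrite setTI (open_rV_bigcup oU) preimage_bigcup.
apply: countable_bigcupT_measurable => // q.
case: ifPn => // _; last by rewrite preimage_set0.
set e : R := q.2.+1%:R^-1.
have e0 : 0 < e by rewrite invr_gt0.
pose q0 : R := ratr (q.1 ord0 ord0).
pose q1 : 'rV[R]_d := \row_i ratr (q.1 ord0 (lift ord0 i)).
rewrite [X in measurable X](_ : _ = ball q0 e `*` ball q1 e); last first.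
  apply/seteqP; split => p /=.
    move=> [_ h]; split.
      by have := h ord0 ord0; rewrite rV_cons0 mxE.
    split => // i j; have := h ord0 (lift ord0 j).
    by rewrite rV_consS (ord1 i) !mxE.
  move=> [h0 [_ h1]]; split => // i j; rewrite (ord1 i).
  case: (unliftP ord0 j) => [k ->|->]; last by rewrite rV_cons0 mxE.
  by have := h1 ord0 k; rewrite rV_consS !mxE.
apply: measurableX.
  by apply: open_measurable; exact: ball_open.
by apply: sub_sigma_algebra; exact: ball_open.
Qed.

Lemma measurable_rV_uncons d : measurable_fun [set: _] (@rV_uncons d).
Proof.
apply/measurable_fun_pairP; split.
  apply: (measurability _ (RGenOpens.measurableE R)).
  move=> _ [_ [a [b ->]] <-]; rewrite setTI; apply: sub_sigma_algebra.
  apply: (@open_comp 'rV[R]_d.+1 _ (fun x => x ord0 ord0)) => [x _|].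
    exact: coord_continuous.
  exact: interval_open.
apply: (@measurability _ _ _ (borel_rV R d) _ _ (@open 'rV[R]_d)) => //.
move=> _ [U oU <-]; rewrite setTI; apply: sub_sigma_algebra.
rewrite /preimage/= openE => x Ux.
have /nbhs_ballP[e /= e0 eU] : nbhs (rsubmx (x : 'rV[R]_(1 + d))) U.
  exact: open_nbhs_nbhs.
apply/nbhs_ballP; exists e => //= y [_ xy]; apply: eU; split => // i j.
by have := xy i (rshift 1 j); rewrite !mxE.
Qed.

Section step.
Context d (mu : {sigma_finite_measure set (borel_rV R d) -> \bar R}).
Local Open Scope ereal_scope.

Definition lebesgue_rV_step : set (borel_rV R d.+1) -> \bar R :=
  pushforward (@lebesgue_measure R \x mu) (@rV_cons d).

Let step0 : lebesgue_rV_step set0 = 0.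
Proof. by rewrite /lebesgue_rV_step /pushforward preimage_set0 measure0. Qed.

Let step_ge0 A : 0 <= lebesgue_rV_step A.
Proof. by rewrite /lebesgue_rV_step /pushforward measure_ge0. Qed.

Let step_sigma_additive : semi_sigma_additive lebesgue_rV_step.
Proof.
move=> F mF tF mUF; rewrite /lebesgue_rV_step /pushforward preimage_bigcup.
apply: measure_semi_sigma_additive.
- move=> n; rewrite -[X in measurable X]setTI.
  by apply: measurable_rV_cons => //; exact: mF.
- apply/trivIsetP => /= i j _ _ ij; rewrite -preimage_setI.
  by move/trivIsetP : tF => /(_ _ _ _ _ ij) ->//; rewrite preimage_set0.
- rewrite -preimage_bigcup -[X in measurable X]setTI.
  by apply: measurable_rV_cons => //; exact: mUF.
Qed.

HB.instance Definition _ := isMeasure.Build _ _ _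
  lebesgue_rV_step step0 step_ge0 step_sigma_additive.

Let sigma_finite_step : sigma_finite setT lebesgue_rV_step.
Proof.
have /sigma_finiteP[F [TF ndF Foo]] := sigma_finiteT (@lebesgue_measure R).
have /sigma_finiteP[G [TG ndG Goo]] := sigma_finiteT mu.
exists (fun n => @rV_uncons d @^-1` (F n `*` G n)).
  apply/esym; rewrite -subTset => x _.
  have [n _ Fn] : (\bigcup_n F n) (rV_uncons x).1 by rewrite -TF.
  have [k _ Gk] : (\bigcup_n G n) (rV_uncons x).2 by rewrite -TG.
  exists (maxn n k) => //; split.
  - exact/(subsetPset _ _ (ndF _ _ (leq_maxl n k))).
  - exact/(subsetPset _ _ (ndG _ _ (leq_maxr n k))).
move=> n; have [mF Fn] := Foo n; have [mG Gn] := Goo n; split.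
  rewrite -[X in measurable X]setTI; apply: measurable_rV_uncons => //.
  exact: measurableX.
rewrite /lebesgue_rV_step /pushforward -comp_preimage.
rewrite (_ : _ \o _ = id); last by apply/funext => p /=; rewrite rV_consK.
rewrite preimage_id product_measure1E//.
by rewrite lte_mul_pinfty// ge0_fin_numE.
Qed.

HB.instance Definition _ := @Measure_isSigmaFinite.Build _ _ _
  lebesgue_rV_step sigma_finite_step.

End step.

(* Lebesgue measure on R^d, by iterated products: R^0 is one point of mass 1 and
   R^d.+1 is identified with R * R^d. *)
Fixpoint lebesgue_rV (d : nat) :
    {sigma_finite_measure set (borel_rV R d) -> \bar R} :=
  if d is d'.+1 then lebesgue_rV_step (lebesgue_rV d')
  else dirac ((0 : 'rV[R]_0) : borel_rV R 0).

Let box d (a b : 'rV[R]_d) : set 'rV[R]_d :=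
  [set x | forall i, a ord0 i <= x ord0 i <= b ord0 i].

Let measurable_box d (a b : 'rV[R]_d) : measurable (box a b : set (borel_rV R d)).
Proof.
rewrite -[X in measurable X]setCK; apply: measurableC.
apply: sub_sigma_algebra; apply: closed_openC.
rewrite (_ : box a b =
    \bigcap_i ((fun x : 'rV[R]_d => x ord0 i) @^-1` `[a ord0 i, b ord0 i])).
  apply: closed_bigI => i _; apply: preimage_closed; last first.
    exact: interval_closed.
  by move=> x _; exact: coord_continuous.
by apply/seteqP; split=> x /= h i => [_|]; move: (h i); rewrite /= in_itv//; exact.
Qed.

Lemma lebesgue_rV_box d (a b : 'rV[R]_d) :
  (forall i, a ord0 i <= b ord0 i) ->
  lebesgue_rV d [set x : 'rV[R]_d |
    forall i, a ord0 i <= x ord0 i <= b ord0 i] =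
  (\prod_i (b ord0 i - a ord0 i))%:E.
Proof.
elim: d a b => [a b _|d IH a b ab].
  by rewrite big_ord0 /= diracE mem_set//= => -[].
pose a' : 'rV[R]_d := \row_i a ord0 (lift ord0 i).
pose b' : 'rV[R]_d := \row_i b ord0 (lift ord0 i).
rewrite big_ord_recl /= /lebesgue_rV_step /pushforward.
rewrite (_ : _ @^-1` _ = `[a ord0 ord0, b ord0 ord0] `*`
    [set x : 'rV[R]_d | forall i, a' ord0 i <= x ord0 i <= b' ord0 i]); last first.
  apply/seteqP; split => p /=.
    move=> h; split.
      by have := h ord0; rewrite rV_cons0 in_itv.
    by move=> i; have := h (lift ord0 i); rewrite rV_consS !mxE.
  rewrite in_itv/= => -[h0 h1] i.
  case: (unliftP ord0 i) => [k ->|->]; last by rewrite rV_cons0.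
  by have := h1 k; rewrite rV_consS !mxE.
rewrite product_measure1E//; last exact: measurable_box.
rewrite [X in (X * _)%E](_ : _ = (b ord0 ord0 - a ord0 ord0)%:E); last first.
  rewrite [LHS]lebesgue_measure_itv/= lte_fin EFinB; have := ab ord0.
  by rewrite le_eqVlt => /predU1P[->|->//]; rewrite ltxx subee.
rewrite IH => [|i]; last by rewrite !mxE.
by rewrite -EFinM; congr (_ * _)%:E; apply: eq_bigr => i _; rewrite !mxE.
Qed.

End lebesgue_measure_rV.

Definition is_norm (R : realType) d (N : 'rV[R]_d -> R) : Prop :=
  [/\ forall x, N x = 0 -> x = 0,
      forall (a : R) x, N (a *: x) = `|a| * N x &
      forall x y, N (x + y) <= N x + N y].

Section quantization.
Context {R : realType} {d : nat}.
Variable N : 'rV[R]_d -> R.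
Implicit Types (x : 'rV[R]_d) (A : set 'rV[R]_d) (P : probability (borel_rV R d) R).

Definition norm_dist x A : R := inf [set N (x - a) | a in A].

Definition norm_ball x (rho : R) : set 'rV[R]_d := [set y | N (y - x) <= rho].

Definition distortion P (r : R) A : \bar R :=
  (\int[P]_x (norm_dist x A `^ r)%:E)%E.

Definition optimal_quantizer P (r : R) (n : nat) A : Prop :=
  [/\ A !=set0, (A #<= `I_n)%card &
      forall B : set 'rV[R]_d, B !=set0 -> (B #<= `I_n)%card ->
        (distortion P r A <= distortion P r B)%E].

(* In \bar R, 0^-1 = +oo and 0 * +oo = 0, so that 0 / 0 = 0 and c / 0 = +oo for
   c > 0. *)
Definition maximal_function P (alpha : nat -> set 'rV[R]_d) (b : R) x : \bar R :=
  ereal_sup [set (lebesgue_rV d (norm_ball x (b * norm_dist x (alpha n))) /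
                  P (norm_ball x (b * norm_dist x (alpha n))))%E
            | n in [set n | (1 <= n)%N]].

End quantization.

Definition mutually_singular d (T : measurableType d) (R : realType)
    (mu nu : set T -> \bar R) : Prop :=
  exists A, [/\ measurable A, mu A = 0%E & nu (~` A) = 0%E].

Definition lebesgue_decomposition d (T : measurableType d) (R : realType)
    (nu mu nua nus : {measure set T -> \bar R}) : Prop :=
  [/\ forall A, measurable A -> nu A = (nua A + nus A)%E,
      nua `<< mu & mutually_singular nus mu].

(* Main.v *)
Require Import Defs.
From mathcomp Require Import all_boot all_order all_algebra.
From mathcomp Require Import all_classical all_reals all_analysis.
From mathcomp Require Import measurable_realfun.
From mathcomp Require Import ring lra.

Set Implicit Arguments.
Unset Strict Implicit.
Unset Printing Implicit Defensive.

Import Order.TTheory GRing.Theory Num.Theory.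
Import numFieldNormedType.Exports.

Local Open Scope classical_set_scope.
Local Open Scope ring_scope.

(** Why the theorem holds.  Write d_n for the distance to alpha_n, e_n for the
    integral of d_n^r against P, and h_n = n^(-1/d) for the natural mesh size of n
    points.  Two estimates on the gap e_n - e_(n+1) are played against each other.

    Lower bound.  Adding a point y to alpha_n gives a competitor for alpha_(n+1).
    On the ball of centre y and radius b * d_n(y) the old distance is at least
    (1 - b) * d_n(y) and the new one at most b * d_n(y), so that
      ((1 - b)^r - b^r) * d_n(y)^r * P(ball) <= e_n - e_(n+1)
    [distortion_add_point].  The Lebesgue measure of the ball is at least of order
    d_n(y)^d, so dividing by P(ball) brings in the maximal function psi_b:
      d_n(y)^(d+r) <= C * psi_b(y) * (e_n - e_(n+1))
    [norm_dist_le_maximal_function].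

    Upper bound.  e_n - e_(n+1) <= C * h_n^(d+r) [distortion_increment].  First,
    e_n <= C * h_n^r: the moment condition allows an explicit quantizer, a grid
    transported by a power function, whose error at x is at most
    C * h_n * (1 + |x|)^(1 + eta/r) [exists_power_quantizer, distortion_rate].
    Next, remove points from alpha_(n+1).  For each x, only the removal of its
    nearest point changes the distance to x; if every point of a set G of removable
    points has another point of alpha_(n+1) within rho, summing over G gives
      #|G| * e_n <= #|G| * e_(n+1) + 2^r * (e_(n+1) + rho^r)
    [distortion_remove_points].  It remains to find such a G with at least g * n
    points for rho of order h_n.  As the absolutely continuous part of P does not
    vanish, Markov's inequality shows that a bounded set of Lebesgue measure bounded
    below lies within C * h_n of alpha_(n+1), which forces order of n points there;
    a volume argument shows that only a small proportion of them can be isolated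
    at scale rho [crowded_count].

    Conclusion.  Together, d_n^(d+r) <= C * psi_b * h_n^(d+r); raising to the power
    s / (d + r) and integrating gives the claim, as h_n^s = n^(-s/d). *)

(** * Norms on row vectors and the distance to a set *)

Lemma rV_coord_le {R : realType} {d : nat} (x : 'rV[R]_d) i : `|x 0 i| <= `|x|.
Proof.
by rewrite [leRHS]/Num.Def.normr/= mx_normrE; apply/bigmax_geP; right; exists (0, i).
Qed.

Lemma rV_norm_le {R : realType} {d : nat} (x : 'rV[R]_d) (c : R) : 0 <= c ->
  (forall i, `|x 0 i| <= c) -> `|x| <= c.
Proof.
move=> c0 xc; rewrite [leLHS]/Num.Def.normr/= mx_normrE.
by apply: bigmax_le => // -[i j] _ /=; rewrite ord1.
Qed.

Section norm_theory.
Context {R : realType} {d : nat} {N : 'rV[R]_d -> R}.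
Context (N_norm : is_norm N).
Implicit Types x y : 'rV[R]_d.

Lemma is_norm0 : N 0 = 0.
Proof. by case: N_norm => _ NZ _; rewrite -(scale0r 0) NZ normr0 mul0r. Qed.

Lemma is_normN x : N (- x) = N x.
Proof. by case: N_norm => _ NZ _; rewrite -scaleN1r NZ normrN1 mul1r. Qed.

Lemma is_norm_ge0 x : 0 <= N x.
Proof.
case: N_norm => _ _ ND; rewrite -(@pmulrn_lge0 _ _ 2)// mulr2n.
by rewrite -[X in _ + X]is_normN (le_trans _ (ND _ _))// subrr is_norm0.
Qed.

Lemma is_normB x y : N (x - y) = N (y - x).
Proof. by rewrite -is_normN opprB. Qed.

Lemma is_norm_triangle y x z : N (x - z) <= N (x - y) + N (y - z).
Proof. by case: N_norm => _ _ /(_ (x - y) (y - z)); rewrite addrA subrK. Qed.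

Lemma is_norm_le_mx : exists2 C : R, 0 < C & forall x, N x <= C * `|x|.
Proof.
exists (1 + \sum_j N (delta_mx 0 j)).
  by rewrite ltr_pwDl// sumr_ge0// => j _; exact: is_norm_ge0.
case: N_norm => _ NZ ND x; rewrite mulrDl mul1r.
rewrite -[leLHS]add0r lerD// mulr_suml {1}[x]row_sum_delta.
elim/big_ind2 : _ => [|u a v b ua vb|j _]; first by rewrite is_norm0.
  by rewrite (le_trans (ND _ _))// lerD.
by rewrite NZ mulrC ler_wpM2l ?is_norm_ge0// rV_coord_le.
Qed.

Lemma is_norm_lip_continuous (f : 'rV[R]_d -> R) :
  (forall x y, f x <= N (x - y) + f y) -> continuous f.
Proof.
have [C C0 NC] := is_norm_le_mx.
move=> flip x; apply/(@cvgrPdist_le R R _ _ (nbhs_filter x)) => e e0; near=> y.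
have h : N (x - y) <= e.
  rewrite (le_trans (NC _))// mulrC -ler_pdivlMr//.
  near: y; apply/nbhs_ballP; exists (e / C); first exact: divr_gt0.
  by move=> y; rewrite mx_norm_ball => /ltW.
have := flip x y; have := flip y x; rewrite (is_normB y x) ler_distl => h1 h2.
by apply/andP; split; lra.
Unshelve. all: by end_near. Qed.

Lemma is_norm_continuous : continuous N.
Proof.
apply: is_norm_lip_continuous => x y.
by case: N_norm => _ _ /(_ (x - y) y); rewrite subrK.
Qed.

(** [N] attains a positive minimum on the unit sphere of the sup norm, which is
    compact; homogeneity does the rest. *)
Lemma mx_le_is_norm : exists2 C : R, 0 < C & forall x, `|x| <= C * N x.
Proof.
pose S : set 'rV[R]_d := [set x | `|x| = 1].
have cS : compact S.
  apply: bounded_closed_compact.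
    exists 1; split; first exact: num_real.
    by move=> M M1 x /= ->; exact: ltW.
  apply: (@preimage_closed _ _ (fun x : 'rV[R]_d => `|x|) [set 1]).
    by move=> x _; exact: norm_continuous.
  exact: closed_eq.
have [[z Sz]|S0] := pselect (S !=set0); last first.
  exists 1 => // x; have [->|x0] := eqVneq x 0.
    by rewrite normr0 mul1r is_norm_ge0.
  exfalso; apply: S0; exists (`|x|^-1 *: x); rewrite /S/=.
  by rewrite normrZ normfV normr_id mulVf// normr_eq0.
have [||c cinS cmin] := @compact_EVT_min _ _ N S _ cS.
- by exists z.
- by apply: continuous_subspaceT; exact: is_norm_continuous.
have Nc : 0 < N c.
  rewrite lt_neqAle is_norm_ge0 andbT eq_sym; apply/eqP.
  case: N_norm => + _ _ => /[apply] c0.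
  by move: cinS; rewrite inE/S/= c0 normr0 => /esym/eqP; rewrite oner_eq0.
exists (N c)^-1; first by rewrite invr_gt0.
move=> x; have [->|x0] := eqVneq x 0.
  by rewrite normr0 mulr_ge0 ?invr_ge0// is_norm_ge0.
rewrite ler_pdivlMl//.
have Sx : `|x|^-1 *: x \in S.
  by rewrite inE /S/= normrZ normfV normr_id mulVf// normr_eq0.
have := cmin _ Sx; case: N_norm => _ -> _; rewrite normfV normr_id.
by rewrite ler_pdivlMl ?normr_gt0// mulrC.
Qed.

(** The source of all measurability below: functions that are 1-Lipschitz for [N]
    are continuous for the product topology, hence Borel. *)
Lemma measurable_is_norm_lip (f : 'rV[R]_d -> R) :
  (forall x y, f x <= N (x - y) + f y) ->
  measurable_fun [set: borel_rV R d] (f : borel_rV R d -> R).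
Proof.
move=> /is_norm_lip_continuous cf.
apply: (measurability _ (RGenOpens.measurableE R)).
move=> _ [_ [a [b ->]] <-]; rewrite setTI; apply: sub_sigma_algebra.
by apply: open_comp => [x _|]; [exact: cf|exact: interval_open].
Qed.

Lemma measurable_is_norm :
  measurable_fun [set: borel_rV R d] (N : borel_rV R d -> R).
Proof.
apply: measurable_is_norm_lip => x y.
by case: N_norm => _ _ /(_ (x - y) y); rewrite subrK.
Qed.

Lemma norm_dist_ge0 x (A : set 'rV[R]_d) : 0 <= norm_dist N x A.
Proof.
have [[a Aa]|/set0P/negP/negPn/eqP ->] := pselect (A !=set0).
  apply: lb_le_inf; first by exists (N (x - a)), a.
  by move=> _ [b _ <-]; exact: is_norm_ge0.
by rewrite /norm_dist image_set0 inf0.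
Qed.

Lemma norm_dist_le x (A : set 'rV[R]_d) a : A a -> norm_dist N x A <= N (x - a).
Proof.
move=> Aa; apply: ge_inf; last by exists a.
by exists 0 => _ [b _ <-]; exact: is_norm_ge0.
Qed.

Lemma norm_dist_attained x (A : set 'rV[R]_d) : finite_set A -> A !=set0 ->
  exists2 a, A a & norm_dist N x A = N (x - a).
Proof.
move=> /finite_seqP[s ->] [a0 /= a0s].
have s0 : (0 < size s)%N by case: s a0s.
pose i0 : 'I_(size s) := Ordinal s0.
have [i _ imin] := @arg_minP _ _ _ i0 xpredT (fun i => N (x - s`_i)) isT.
exists s`_i; first by rewrite /= mem_nth.
apply/eqP; rewrite eq_le norm_dist_le/=; last by rewrite mem_nth.
apply: lb_le_inf; first by exists (N (x - a0)), a0.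
move=> _ [a /= /(nthP 0)[k ks <-] <-].
exact: (imin (Ordinal ks)).
Qed.

Lemma norm_dist_subset x (A B : set 'rV[R]_d) : A !=set0 -> A `<=` B ->
  norm_dist N x B <= norm_dist N x A.
Proof.
move=> [a0 Aa0] AB; apply: lb_le_inf; first by exists (N (x - a0)), a0.
by move=> _ [a Aa <-]; apply: norm_dist_le; exact: AB.
Qed.

Lemma norm_dist_lip x y (A : set 'rV[R]_d) : A !=set0 ->
  norm_dist N x A <= N (x - y) + norm_dist N y A.
Proof.
move=> [a0 Aa0]; rewrite -lerBlDl; apply: lb_le_inf; first by exists (N (y - a0)), a0.
move=> _ [a Aa <-]; rewrite lerBlDl (le_trans (norm_dist_le x Aa))//.
exact: is_norm_triangle.
Qed.

Lemma measurable_norm_dist (A : set 'rV[R]_d) : A !=set0 ->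
  measurable_fun [set: borel_rV R d] (fun x : borel_rV R d => norm_dist N x A).
Proof. by move=> A0; apply: measurable_is_norm_lip => x y; exact: norm_dist_lip. Qed.

Lemma measurable_norm_ball x (rho : R) :
  measurable (norm_ball N x rho : set (borel_rV R d)).
Proof.
have -> : norm_ball N x rho = norm_ball N x rho `&` setT by rewrite setIT.
rewrite setIC; apply: (@measurable_fun_le _ (borel_rV R d) R setT
  (fun y => N (y - x)) (cst rho)) => //.
apply: measurable_is_norm_lip => y z; rewrite -lerBlDr.
have := is_norm_triangle z y x; lra.
Qed.

End norm_theory.

(** * Covering and packing by cubes, and absolute continuity *)

Section cubes.
Context {R : realType} {d : nat}.
Implicit Types (x y : 'rV[R]_d) (s : seq 'rV[R]_d) (rho : R).

Lemma is_norm_mx : is_norm (fun x : 'rV[R]_d => `|x|).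
Proof.
by split=> [x /normr0_eq0//|a x|x y]; [rewrite normrZ|rewrite ler_normD].
Qed.

Local Notation cube := (norm_ball (fun x : 'rV[R]_d => `|x|)).

Lemma lebesgue_rV_cube x rho : 0 <= rho ->
  lebesgue_rV d (cube x rho) = ((2 * rho) ^+ d)%:E.
Proof.
move=> rho0.
have -> : cube x rho = [set y : 'rV[R]_d | forall i,
    (x - const_mx rho) ord0 i <= y ord0 i <= (x + const_mx rho) ord0 i].
  apply/seteqP; split=> y /=.
    move=> xy i; rewrite !mxE -ler_distl (le_trans _ xy)//.
    by rewrite (le_trans _ (rV_coord_le (y - x) i))// !mxE.
  move=> h; apply: rV_norm_le => // i; rewrite !mxE ler_distl.
  by have := h i; rewrite !mxE.
rewrite lebesgue_rV_box => [|i]; last by rewrite !mxE; lra.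
congr EFin; rewrite (eq_bigr (fun=> 2 * rho)).
  by rewrite prodr_const card_ord.
by move=> i _; rewrite !mxE; ring.
Qed.

Lemma measurable_cube x rho : measurable (cube x rho : set (borel_rV R d)).
Proof. exact: measurable_norm_ball is_norm_mx _ _. Qed.

Lemma lebesgue_rV_cover s (E : set (borel_rV R d)) rho : 0 <= rho ->
  measurable E -> (forall x, E x -> exists2 a, a \in s & `|x - a| <= rho) ->
  (lebesgue_rV d E <= ((size s)%:R * (2 * rho) ^+ d)%:E)%E.
Proof.
move=> rho0 mE sE.
apply: (@le_trans _ _ (lebesgue_rV d (\big[setU/set0]_(i < size s) cube s`_i rho))).
  apply: le_measure; rewrite ?inE//.
    by apply: bigsetU_measurable => i _; exact: measurable_cube.
  move=> x /sE[a /(nthP 0)[i si <-] xa].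
  by rewrite -(bigcup_mkord _ (fun i => cube s`_i rho)); exists i.
apply: (le_trans (@Boole_inequality _ R (borel_rV R d) (lebesgue_rV d)
  (fun i => cube s`_i rho) (size s) _)) => [i _|]; first exact: measurable_cube.
rewrite (eq_bigr (fun=> ((2 * rho) ^+ d)%:E)) => [|i _]; last exact: lebesgue_rV_cube.
by rewrite sumEFin sumr_const card_ord [X in (_ <= X%:E)%E]mulr_natl.
Qed.

Lemma lebesgue_rV_packing s (K rho : R) : 0 <= rho -> 0 <= K -> uniq s ->
  {in s &, forall a b, a != b -> 2 * rho < `|a - b|} ->
  {in s, forall a, `|a| <= K} ->
  (size s)%:R * (2 * rho) ^+ d <= (2 * (K + rho)) ^+ d.
Proof.
move=> rho0 K0 us sep sK.
have sin (i : 'I_(size s)) : s`_i \in s by rewrite mem_nth.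
rewrite -lee_fin -(lebesgue_rV_cube 0) ?addr_ge0//.
rewrite [leLHS](_ : _ = lebesgue_rV d
    (\big[setU/set0]_(i < size s) cube s`_i rho)).
  apply: le_measure; rewrite ?inE//.
  - by apply: bigsetU_measurable => i _; exact: measurable_cube.
  - exact: measurable_cube.
  - rewrite -(bigcup_mkord _ (fun i => cube s`_i rho)) => x [i /= si xi].
    rewrite /norm_ball/= subr0.
    rewrite -(subrK s`_i x) addrC (le_trans (ler_normD _ _))// lerD//.
    exact: (sK _ (sin (Ordinal si))).
rewrite measure_bigsetU_ord.
- rewrite (eq_bigr (fun=> ((2 * rho) ^+ d)%:E)) => [|i _]; last exact: lebesgue_rV_cube.
  by rewrite sumEFin sumr_const card_ord mulr_natl.
- by move=> i; exact: measurable_cube.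
- apply/trivIsetP => i j _ _ ij; apply/seteqP; split=> // x [/= xi xj].
  have := sep _ _ (sin i) (sin j); rewrite nth_uniq// => /(_ ij).
  rewrite ltNge => /negP; apply.
  rewrite -(subrKA x) (le_trans (ler_normD _ _))// -(distrC x).
  by rewrite mulrDl mul1r lerD.
Qed.

End cubes.

(** The epsilon-delta form of absolute continuity: a finite measure is a charge,
    bounded by its variation, to which the criterion for charges applies. *)
Lemma finite_measure_abs_continuous d (T : measurableType d) (R : realType)
    (nu : {finite_measure set T -> \bar R}) (mu : {measure set T -> \bar R}) :
  nu `<< mu -> forall e : R, 0 < e -> exists2 delta : R, 0 < delta &
    forall A, measurable A -> (mu A < delta%:E)%E -> (nu A < e%:E)%E.
Proof.
move=> numu e e0.
have [P [Q PQ]] := Hahn_decomposition (charge_of_finite_measure nu).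
have [delta [delta0 h]] :=
  @charge_variation_continuous _ _ _ (charge_of_finite_measure nu) _ _ PQ mu numu e e0.
exists delta => // A mA /(h _ mA); apply: le_lt_trans.
by rewrite (le_trans _ (abse_charge_variation PQ mA))// lee_abs.
Qed.

(** * A quantizer adapted to polynomial tails *)

Section card_le_seq.
Context {T : choiceType}.

Lemma card_le_seq (s : seq T) n : (size s <= n)%N -> ([set` s] #<= `I_n)%card.
Proof.
case: s => [_|x s sn]; first by rewrite set_nil; exact: card_ge0.
apply: (@card_le_trans _ _ _ (nth x (x :: s) @` `I_n)); last exact: card_image_le.
apply: subset_card_le => y /= /(nthP x)[i si <-]; exists i => //=.
exact: leq_trans si sn.
Qed.

Lemma seq_card_le (A : set T) n : (A #<= `I_n)%card ->
  exists s : seq T, [/\ uniq s, (size s <= n)%N & A = [set` s]].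
Proof.
move=> An; have fA : finite_set A by apply/finite_set_leP; exists n.
exists (finmap.enum_fset (fset_set A)); split; last by rewrite fset_setK.
- exact: finmap.fset_uniq.
- exact: geq_card_fset_set.
Qed.

End card_le_seq.

Section mesh.
Context {R : realType} (d : nat).
Context (d_gt0 : (0 < d)%N).

(** The scale n^(-1/d) of an optimal configuration of [n] points in a bounded part
    of the space. *)
Definition mesh (n : nat) : R := n%:R `^ (- d%:R^-1).

Lemma mesh_gt0 n : (0 < n)%N -> 0 < mesh n.
Proof. by move=> n0; rewrite powR_gt0// ltr0n. Qed.

Lemma mesh_expn n : mesh n ^+ d = n%:R^-1.
Proof.
rewrite -powR_mulrn ?powR_ge0// /mesh -powRrM mulNr mulVf ?powR_inv1//.
by rewrite pnatr_eq0 -lt0n.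
Qed.

End mesh.

Section power_grid.
Context {R : realType} (th : R).
Context (th_gt0 : 0 < th).

(** The image of the regular grid j/m under u |-> (1 - u)^(-1/th) - 1.  The
    derivative of this map at a point of value t is (1 + t)^(1 + th) / th, so
    consecutive grid points near t are at distance about (1 + t)^(1 + th) / (th * m):
    the spacing grows with t just as fast as the moment condition permits. *)
Let grid_pt (m j : nat) : R := (1 - j%:R / m%:R) `^ (- th^-1) - 1.

Let grid_ge0 (m : nat) (t : R) : (0 < m)%N -> 0 <= t ->
  exists j : 'I_m, `|t - grid_pt m j| <= (1 + t) `^ (1 + th) / (th * m%:R).
Proof.
move=> m0 t0; set p := th^-1.
have p0 : 0 < p by rewrite invr_gt0.
have mR0 : 0 < m%:R :> R by rewrite ltr0n.
(* t is the value at 1 - w; the grid point is the last one before 1 - w *)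
pose w : R := (1 + t) `^ (- th).
have w0 : 0 < w by rewrite powR_gt0//; lra.
have w1 : w <= 1.
  rewrite /w powRN invf_le1 ?powR_gt0//; last by lra.
  have : (1 + t) `^ 0 <= (1 + t) `^ th by apply: ler_powR; rewrite ?lerDl// ltW.
  by rewrite powRr0.
have mw0 : 0 <= m%:R * (1 - w) by rewrite mulr_ge0 ?subr_ge0.
have /andP[j1 j2] := truncn_itv mw0.
set j := Num.trunc _ in j1 j2.
have jm : (j < m)%N.
  by rewrite -(ltr_nat R) (le_lt_trans j1)// -[ltRHS]mulr1 ltr_pM2l//; lra.
exists (Ordinal jm); rewrite /grid_pt/= -/p; set v := 1 - _ / _.
have wv : w <= v.
  have : j%:R / m%:R <= 1 - w by rewrite ler_pdivrMr// mulrC.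
  by rewrite /v; lra.
have vw : v - w <= m%:R^-1.
  have : 1 - w <= (j%:R + 1) / m%:R.
    by rewrite ler_pdivlMr// mulrC natr1 ltW.
  by rewrite /v mulrDl mul1r; lra.
have v0 : 0 < v by exact: lt_le_trans wv.
have tE : t = w `^ (- p) - 1.
  rewrite /w -powRrM mulrNN /p divff ?gt_eqF// powRr1//; lra.
have tE1 : (1 + t) `^ (1 + th) = w `^ (- p) * w^-1.
  rewrite powRD; last by apply/implyP => _; rewrite gt_eqF//; lra.
  rewrite powRr1; last lra.
  by congr (_ * _); [lra|rewrite /w powRN invrK].
rewrite tE1 {1}tE.
have -> : w `^ (- p) - 1 - (v `^ (- p) - 1) = w `^ (- p) - v `^ (- p) by ring.
have vE : v `^ (- p) = w `^ (- p) * (v / w) `^ (- p).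
  rewrite -powRM ?ltW//; last exact: divr_gt0.
  by rewrite mulrC divfK ?gt_eqF.
rewrite vE -{1}[w `^ (- p)]mulr1 -mulrBr.
have z1 : 1 <= v / w by rewrite ler_pdivlMr ?mul1r.
(* mean value inequality, from 1 + x <= exp x and ln z <= z - 1 *)
have zp : 1 - (v / w) `^ (- p) <= p * (v / w - 1).
  rewrite /powR gt_eqF; last lra.
  have := expR_ge1Dx (- p * ln (v / w)).
  have : ln (v / w) <= v / w - 1.
    by have := @le_ln1Dx R (v / w - 1); rewrite [1 + _]addrC subrK; apply; lra.
  rewrite -(ler_pM2l p0) mulNr; lra.
have zp0 : 0 <= 1 - (v / w) `^ (- p).
  rewrite subr_ge0 powRN invf_le1 ?powR_gt0//; last lra.
  have : (v / w) `^ 0 <= (v / w) `^ p by apply: ler_powR => //; rewrite ltW.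
  by rewrite powRr0.
rewrite ger0_norm; last by rewrite mulr_ge0 ?powR_ge0.
rewrite -mulrA ler_wpM2l ?powR_ge0// (le_trans zp)//.
have -> : v / w - 1 = (v - w) / w by field; rewrite gt_eqF.
rewrite invfM -/p [leRHS]mulrCA ler_wpM2l ?(ltW p0)// [leLHS]mulrC.
by rewrite ler_wpM2l ?invr_ge0 ?(ltW w0).
Qed.

(** Negative abscissae are served by the opposite grid, selected by the boolean. *)
Lemma power_grid1 (m : nat) : (0 < m)%N -> exists f : bool * 'I_m -> R,
  forall t : R, exists i, `|t - f i| <= (1 + `|t|) `^ (1 + th) / (th * m%:R).
Proof.
move=> m0; exists (fun i : bool * 'I_m => (-1) ^+ i.1 * grid_pt m i.2) => t.
have [t0|t0] := leP 0 t.
  by have [j hj] := grid_ge0 m0 t0; exists (false, j); rewrite (ger0_norm t0) /= expr0 mul1r.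
have nt0 : 0 <= - t by rewrite oppr_ge0 ltW.
have [j hj] := grid_ge0 m0 nt0; exists (true, j) => /=.
by rewrite (ltr0_norm t0) expr1 mulN1r opprK -normrN opprD.
Qed.

(** In the sup norm a product of one-dimensional quantizers is as good as its
    factors. *)
Lemma power_grid (d m : nat) : (0 < m)%N -> exists s : seq 'rV[R]_d,
  size s = ((2 * m) ^ d)%N /\
  forall x, exists2 a, a \in s & `|x - a| <= (1 + `|x|) `^ (1 + th) / (th * m%:R).
Proof.
move=> m0; have [f hf] := power_grid1 m0.
pose F (g : {ffun 'I_d -> bool * 'I_m}) : 'rV[R]_d := \row_i f (g i).
exists (map F (enum {: {ffun 'I_d -> bool * 'I_m}})); split.
  by rewrite size_map -cardE card_ffun card_prod card_bool !card_ord.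
move=> x; have [g hg] := choice (fun i => hf (x 0 i)).
exists (F [ffun i => g i]); first by rewrite map_f// mem_enum.
have D0 : 0 < th * m%:R by rewrite mulr_gt0// ltr0n.
apply: rV_norm_le => [|i]; first by rewrite divr_ge0 ?powR_ge0 ?ltW.
rewrite !mxE ffunE (le_trans (hg i))// ler_pM2r ?invr_gt0//.
apply: ge0_ler_powR; rewrite ?nnegrE ?addr_ge0//; first exact: ltW.
by rewrite lerD2l rV_coord_le.
Qed.

End power_grid.

Section quantizer_rate.
Context {R : realType} (d : nat) (th : R).
Context (d_gt0 : (0 < d)%N) (th_gt0 : 0 < th).

(** The weight (1 + |x|)^(1 + th) is what makes a pointwise error bound of order
    [mesh d n] possible on the whole space; with th = eta / r its r-th power is
    integrable against a measure with a moment of order r + eta. *)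
Lemma exists_power_quantizer : exists2 C : R, 0 < C &
  forall n, (0 < n)%N -> exists s : seq 'rV[R]_d,
  [/\ (0 < size s)%N, (size s <= n)%N & forall x, exists2 a, a \in s &
    `|x - a| <= C * mesh d n * (1 + `|x|) `^ (1 + th)].
Proof.
exists (2 + 4 / th); first by rewrite addr_gt0// divr_gt0.
move=> n n0; set h : R := mesh d n.
have h0 : 0 < h by exact: mesh_gt0.
have hd : h ^+ d = n%:R^-1 by exact: mesh_expn.
have th4 : 0 < 4 / th by exact: divr_gt0.
(* below 2^d points there is no room for a grid with m >= 1: the origin will do *)
have [h2|h2] := leP (2 * h) 1; last first.
  exists [:: 0]; split=> // x; exists 0; first exact: mem_head.
  rewrite subr0 (@le_trans _ _ (1 + `|x|)) ?lerDr//.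
  rewrite (@le_trans _ _ ((1 + `|x|) `^ (1 + th)))//.
    by apply: le1r_powR; rewrite ?lerDl// ltW.
  rewrite -[leLHS]mul1r ler_wpM2r ?powR_ge0//.
  have := mulr_gt0 th4 h0; lra.
pose m := Num.trunc (2 * h)^-1.
have m0 : (0 < m)%N by rewrite truncn_gt0 invf_ge1//; lra.
have /andP[m1 m2] : m%:R <= (2 * h)^-1 < m.+1%:R.
  by apply: truncn_itv; rewrite invr_ge0; lra.
have [s [ss hs]] := power_grid th_gt0 d m0.
exists s; split; first by rewrite ss expn_gt0 muln_gt0 m0.
  rewrite ss -(ler_nat R) natrX natrM -[n%:R]invrK -hd -exprVn.
  rewrite lerXn2r ?nnegrE ?invr_ge0 ?mulr_ge0 ?(ltW h0)//.
  by move: m1; rewrite invfM -ler_pdivlMl ?invr_gt0// invrK.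
move=> x; have [a as_ xa] := hs x; exists a => //.
rewrite (le_trans xa)// mulrC ler_wpM2r ?powR_ge0//.
have mR : 1 <= m%:R :> R by rewrite (ler_nat _ 1).
have mh : 1 <= 4 * h * m%:R.
  have : (2 * h)^-1 < m%:R + 1 by rewrite natr1.
  rewrite -[(2 * h)^-1]mul1r ltr_pdivrMr; last lra.
  have : h <= h * m%:R by rewrite ler_peMr// ltW.
  lra.
rewrite invfM -(@ler_pM2l _ (th * m%:R)) ?mulr_gt0 ?ltr0n//.
have -> : th * m%:R * (th^-1 / m%:R) = 1.
  by field; rewrite !gt_eqF// ltr0n.
have -> : th * m%:R * ((2 + 4 / th) * h) = 2 * (th * m%:R * h) + 4 * h * m%:R.
  by field; rewrite gt_eqF.
have : 0 <= th * m%:R * h by rewrite !mulr_ge0// ltW.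
lra.
Qed.

End quantizer_rate.

(** * Distortion: rate of decrease, adding and removing points *)

Lemma integral_probability_cst disp (T : measurableType disp) (R : realType)
    (P : probability T R) (c : \bar R) : (\int[P]_x c = c)%E.
Proof.
have /= -> := @integral_cst _ _ _ P setT measurableT c.
by rewrite probability_setT mule1.
Qed.

Lemma powR_mono (R : realType) (r a b : R) :
  0 <= r -> 0 <= a -> a <= b -> a `^ r <= b `^ r.
Proof. by move=> r0 a0 ab; apply: ge0_ler_powR; rewrite ?nnegrE// (le_trans a0). Qed.

Section distortion_theory.
Context {R : realType} {d : nat} {N : 'rV[R]_d -> R}.
Context (N_norm : is_norm N) (P : probability (borel_rV R d) R).
Implicit Types (x y : 'rV[R]_d) (A B : set 'rV[R]_d) (s : seq 'rV[R]_d) (r : R).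

Lemma measurable_norm_dist_powR A r : A !=set0 ->
  measurable_fun [set: borel_rV R d] (fun x : borel_rV R d => (norm_dist N x A `^ r)%:E).
Proof.
move=> A0; apply/measurable_EFinP.
exact: (measurableT_comp (measurable_powR r) (measurable_norm_dist N_norm A0)).
Qed.

Lemma le_distortion A B r : 0 <= r -> A !=set0 -> B !=set0 ->
  (forall x, norm_dist N x A <= norm_dist N x B) ->
  (distortion N P r A <= distortion N P r B)%E.
Proof.
move=> r0 A0 B0 AB; apply: ge0_le_integral => //.
- by move=> x _; rewrite lee_fin powR_ge0.
- exact: measurable_norm_dist_powR.
- exact: measurable_norm_dist_powR.
- by move=> x _; rewrite lee_fin powR_mono// norm_dist_ge0.
Qed.

Lemma distortion_ge0 A r : (0 <= distortion N P r A)%E.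
Proof. by apply: integral_ge0 => x _; rewrite lee_fin powR_ge0. Qed.

(** On the ball of radius b * D around [y], where D is the distance from [y] to [A],
    the distance falls from at least (1 - b) * D to at most b * D once [y] is added;
    elsewhere it does not increase. *)
Lemma distortion_add_point A y r b : 0 < r -> A !=set0 -> 0 <= b <= 1 ->
  (distortion N P r (y |` A) +
   (((1 - b) `^ r - b `^ r) * norm_dist N y A `^ r)%:E *
     P (norm_ball N y (b * norm_dist N y A)) <= distortion N P r A)%E.
Proof.
move=> r0 A0 /andP[b0 b1]; set D := norm_dist N y A; set k := _ * _.
have D0 : 0 <= D by exact: norm_dist_ge0.
have yA0 : (y |` A) !=set0 by exists y; left.
(* for b > 1/2 the constant may be negative and the claim is monotonicity *)
have [k0|k0] := leP 0 k; last first.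
  rewrite (@le_trans _ _ (distortion N P r (y |` A) + 0)%E)//.
    by rewrite leeD2l// mule_le0_ge0// lee_fin ltW.
  rewrite adde0; apply: le_distortion => //; first exact: ltW.
  by move=> x; apply: norm_dist_subset => // a Aa; right.
set Bl := norm_ball _ _ _.
have mB : measurable (Bl : set (borel_rV R d)) by exact: measurable_norm_ball.
have -> : (k%:E * P Bl = \int[P]_x (k%:E * (\1_Bl x)%:E))%E.
  rewrite ge0_integralZl_EFin//; first by rewrite integral_indic// setIT.
  by apply/measurable_EFinP; exact: measurable_indic.
have mk : measurable_fun [set: borel_rV R d] (fun x => (k%:E * (\1_Bl x)%:E)%E).
  by apply: measurable_funeM; apply/measurable_EFinP; exact: measurable_indic.
rewrite /distortion -ge0_integralD//; last 3 first.
- by move=> x _; rewrite lee_fin powR_ge0.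
- exact: measurable_norm_dist_powR.
- by move=> x _; rewrite mule_ge0.
apply: ge0_le_integral => //.
- by move=> x _; rewrite adde_ge0 ?mule_ge0// lee_fin powR_ge0.
- by apply: emeasurable_funD => //; exact: measurable_norm_dist_powR.
- exact: measurable_norm_dist_powR.
move=> x _; rewrite -EFinM -EFinD lee_fin indicE.
have [xB|xB] := boolP (x \in Bl); last first.
  rewrite mulr0 addr0; apply: powR_mono (ltW r0) (norm_dist_ge0 N_norm _ _) _.
  by apply: norm_dist_subset => // a Aa; right.
move: xB; rewrite inE /Bl /norm_ball/= => xB.
have h1 : norm_dist N x (y |` A) <= b * D.
  by apply: le_trans xB; apply: norm_dist_le => //; left.
have h2 : (1 - b) * D <= norm_dist N x A.
  have := norm_dist_lip N_norm y x A0; rewrite (is_normB N_norm y x) -/D; lra.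
rewrite mulr1 /k mulrBl -!powRM//; last by rewrite subr_ge0.
have h1' := powR_mono (ltW r0) (norm_dist_ge0 N_norm _ _) h1.
have h2' : ((1 - b) * D) `^ r <= norm_dist N x A `^ r.
  by apply: powR_mono => //; [exact: ltW|rewrite mulr_ge0// subr_ge0].
lra.
Qed.

(** Pierce's bound, by comparison with the quantizer of [exists_power_quantizer]. *)
Lemma distortion_rate r eta : 0 < r -> 0 < eta -> (0 < d)%N ->
  (\int[P]_x (N x `^ (r + eta))%:E < +oo)%E ->
  exists2 E : R, 0 < E & forall n A, (0 < n)%N -> optimal_quantizer N P r n A ->
    (distortion N P r A <= (E * mesh d n `^ r)%:E)%E.
Proof.
move=> r0 eta0 d0 Mfin; set q := r + eta.
have q0 : 0 < q by rewrite addr_gt0.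
have [C1 C10 NC] := is_norm_le_mx N_norm; have [C2 C20 CN] := mx_le_is_norm N_norm.
have th0 : 0 < eta / r by rewrite divr_gt0.
have [C C0 hC] := exists_power_quantizer (R := R) d0 th0.
set I := (\int[P]_x _)%E in Mfin.
have I0 : (0 <= I)%E by apply: integral_ge0 => x _; rewrite lee_fin powR_ge0.
have If : I \is a fin_num by rewrite ge0_fin_numE.
pose k := (2 * (1 + C2)) `^ q.
have k0 : 0 < k by rewrite powR_gt0// mulr_gt0// addr_gt0.
have growth x : (1 + `|x|) `^ q <= k * (1 + N x `^ q).
  have N0 : 0 <= N x by exact: is_norm_ge0.
  rewrite (@le_trans _ _ ((2 * (1 + C2) * Num.max 1 (N x)) `^ q))//.
    apply: powR_mono; [exact: ltW|by rewrite addr_ge0|].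
    have m1 : 1 <= Num.max 1 (N x) by rewrite le_max lexx.
    have m2 : N x <= Num.max 1 (N x) by rewrite le_max lexx orbT.
    have := CN x; have : C2 * N x <= C2 * Num.max 1 (N x) by rewrite ler_pM2l.
    have : 0 <= C2 * Num.max 1 (N x) by rewrite mulr_ge0 ?ltW// (lt_le_trans _ m1).
    lra.
  rewrite powRM; last 2 first.
  - by rewrite mulr_ge0// addr_ge0// ltW.
  - by rewrite le_max ler01.
  rewrite ler_pM2l//; have [_|_] := leP 1 (N x); first by rewrite lerDr.
  by rewrite powR1 lerDl powR_ge0.
exists ((C1 * C) `^ r * k * (1 + fine I)).
  rewrite !mulr_gt0//; first by rewrite powR_gt0// mulr_gt0.
  by rewrite (lt_le_trans ltr01)// lerDl fine_ge0.
move=> n A n0 [A0 _ Aopt]; have [s [s0 sn hs]] := hC _ n0.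
have h0 := mesh_gt0 (R := R) d n0; set h := mesh d n in hs h0 *.
have S0 : [set` s] !=set0 by case: s s0 {sn hs} => // a s _; exists a; exact: mem_head.
apply: (le_trans (Aopt _ S0 (card_le_seq sn))).
pose c := (C1 * C * h) `^ r * k.
have c0 : 0 <= c by rewrite mulr_ge0 ?powR_ge0// ltW.
have mN : measurable_fun [set: borel_rV R d] (fun x : borel_rV R d => (N x `^ q)%:E).
  apply/measurable_EFinP.
  exact: (measurableT_comp (measurable_powR q) (measurable_is_norm N_norm)).
apply: (@le_trans _ _ (\int[P]_x (c%:E * (1 + (N x `^ q)%:E)))%E); last first.
  rewrite ge0_integralZl_EFin//; last 2 first.
  - by move=> x _; rewrite adde_ge0// lee_fin powR_ge0.
  - exact: emeasurable_funD.
  rewrite ge0_integralD//=; last by move=> x _; rewrite lee_fin powR_ge0.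
  rewrite integral_probability_cst -/I.
  rewrite -(fineK If) -EFinD -EFinM lee_fin /c.
  rewrite powRM ?mulr_ge0 ?(ltW C10) ?(ltW C0) ?(ltW h0)//.
  by rewrite le_eqVlt; apply/orP; left; apply/eqP; ring.
apply: ge0_le_integral => //.
- by move=> x _; rewrite lee_fin powR_ge0.
- exact: measurable_norm_dist_powR.
- by apply: measurable_funeM; exact: emeasurable_funD.
move=> x _; rewrite -EFinD -EFinM lee_fin.
have [a as_ xa] := hs x.
have step : norm_dist N x [set` s] <= C1 * C * h * (1 + `|x|) `^ (1 + eta / r).
  apply: (le_trans (norm_dist_le N_norm x (as_ : [set` s] a))).
  by apply: (le_trans (NC _)); rewrite -!mulrA ler_pM2l// mulrA.
apply: (le_trans (powR_mono (ltW r0) (norm_dist_ge0 N_norm _ _) step)).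
have CC0 : 0 <= C1 * C * h by rewrite !mulr_ge0// ltW.
rewrite powRM ?powR_ge0//.
rewrite -powRrM (_ : (1 + eta / r) * r = q); last by rewrite /q; field; rewrite gt_eqF.
by rewrite /c -[leRHS]mulrA ler_wpM2l ?powR_ge0.
Qed.

(** For each x, removing a point other than the nearest one a0 does not change the
    distance from x, and removing a0 raises it by at most [rho].  Hence the sum over
    [G] of the r-th powers exceeds #|G| * d^r by at most (d + rho)^r, where d is the
    distance from x to [s]. *)
Lemma distortion_remove_points s (G : seq 'rV[R]_d) r (rho : R) (v : \bar R) :
  0 < r -> 0 <= rho -> uniq s -> uniq G ->
  {in G, forall a, a \in s /\ exists b, [/\ b \in s, b != a & N (a - b) <= rho]} ->
  {in G, forall a, (v <= distortion N P r [set` rem a s])%E} ->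
  ((size G)%:R%:E * v <= (size G)%:R%:E * distortion N P r [set` s] +
     (2 `^ r)%:E * (distortion N P r [set` s] + (rho `^ r)%:E))%E.
Proof.
move=> r0 rho0 us uG Gs Gv.
have [->|G0] := eqVneq G [::].
  rewrite /= !mul0e add0e mule_ge0 ?lee_fin ?powR_ge0//.
  by rewrite adde_ge0 ?distortion_ge0// lee_fin powR_ge0.
have S0 : [set` s] !=set0.
  by case: G G0 Gs {uG Gv} => // a G _ /(_ a (mem_head _ _))[as_ _]; exists a.
have mS := measurable_norm_dist_powR r S0.
have rem0 a : a \in G -> [set` rem a s] !=set0.
  by move=> /Gs[_ [b [bs ba _]]]; exists b; rewrite /= mem_rem_uniq// inE ba.
pose f a : borel_rV R d -> \bar R := fun x =>
  if a \in G then (norm_dist N x [set` rem a s] `^ r)%:E else 0%E.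
have f0 a x : [set: borel_rV R d] x -> (0 <= f a x)%E.
  by rewrite /f; case: ifP => // _ _; rewrite lee_fin powR_ge0.
have mf a : measurable_fun [set: borel_rV R d] (f a).
  rewrite /f; case: (boolP (a \in G)) => aG; last exact: measurable_cst.
  by apply: measurable_norm_dist_powR; exact: rem0.
apply: (@le_trans _ _ (\sum_(a <- G) \int[P]_x f a x)%E).
  rewrite -[X in (X <= _)%E](_ : \sum_(a <- G) v = _)%E; last first.
    elim: (G) => [|a l IH]; first by rewrite big_nil /= mul0e.
    by rewrite big_cons IH /= -natr1 EFinD ge0_muleDl// mul1e addeC.
  rewrite big_seq [leRHS]big_seq; apply: lee_sum => a aG.
  by rewrite /f aG; exact: Gv.
rewrite -ge0_integral_sum//.
pose g (x : borel_rV R d) := (((size G)%:R + 2 `^ r)%:E * (norm_dist N x [set` s] `^ r)%:E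
   + (2 `^ r * rho `^ r)%:E)%E.
apply: (@le_trans _ _ (\int[P]_x g x)%E); last first.
  rewrite ge0_integralD//; last 3 first.
  - by move=> x _; rewrite mule_ge0 ?lee_fin ?addr_ge0 ?powR_ge0.
  - exact: measurable_funeM.
  - by move=> x _; rewrite lee_fin mulr_ge0 ?powR_ge0.
  rewrite ge0_integralZl_EFin ?addr_ge0 ?powR_ge0//; last first.
    by move=> x _; rewrite lee_fin powR_ge0.
  rewrite integral_probability_cst.
  have De0 := distortion_ge0 [set` s] r.
  have p0 (a : R) : (0 <= (a `^ r)%:E)%E by rewrite lee_fin powR_ge0.
  rewrite -/(distortion N P r [set` s]) [in leLHS]EFinD [in leLHS]EFinM.
  move: (distortion N P r [set` s]) De0 => De De0.
  by rewrite ge0_muleDl// ge0_muleDr// addeA.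
apply: ge0_le_integral => //.
- by move=> x _; apply: sume_ge0 => a _; exact: f0.
- exact: emeasurable_sum.
- by apply: emeasurable_funD => //; exact: measurable_funeM.
move=> x _; rewrite /g.
have [a0 a0s xa0] := norm_dist_attained N_norm x (finite_seq s) S0.
set D := norm_dist N x [set` s] in xa0 *.
have D0 : 0 <= D by exact: norm_dist_ge0.
have other a : a \in G -> a != a0 -> norm_dist N x [set` rem a s] <= D.
  move=> aG aa0; rewrite xa0; apply: norm_dist_le => //=.
  by rewrite mem_rem_uniq// inE eq_sym aa0.
have self : a0 \in G -> norm_dist N x [set` rem a0 s] <= D + rho.
  move=> /Gs[_ [b [bs ba bD]]]; rewrite xa0.
  apply: (@le_trans _ _ (N (x - b))).
    by apply: norm_dist_le => //=; rewrite mem_rem_uniq// inE ba.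
  by apply: (le_trans (is_norm_triangle N_norm a0 _ _)); rewrite lerD2l.
have split2 : (D + rho) `^ r <= 2 `^ r * (D `^ r + rho `^ r).
  apply: (@le_trans _ _ ((2 * Num.max D rho) `^ r)).
    apply: powR_mono; [exact: ltW|exact: addr_ge0|].
    have : D <= Num.max D rho by rewrite le_max lexx.
    have : rho <= Num.max D rho by rewrite le_max lexx orbT.
    lra.
  rewrite powRM//; last by rewrite le_max D0.
  rewrite ler_wpM2l ?powR_ge0//; have [_|_] := leP D rho.
    by rewrite lerDr powR_ge0.
  by rewrite lerDl powR_ge0.
apply: (@le_trans _ _ (\sum_(a <- G)
  (D `^ r + (a == a0)%:R * (2 `^ r * (D `^ r + rho `^ r)))%:E)%E).
  rewrite big_seq [leRHS]big_seq; apply: lee_sum => a aG.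
  rewrite /f aG lee_fin; have [aa0|aa0] := eqVneq a a0.
    rewrite aa0 in aG *; rewrite mul1r.
    have := powR_mono (ltW r0) (norm_dist_ge0 N_norm _ _) (self aG).
    have := powR_ge0 D r; lra.
  rewrite mul0r addr0; apply: powR_mono (ltW r0) (norm_dist_ge0 N_norm _ _) _.
  exact: other.
rewrite sumEFin -EFinM -EFinD lee_fin big_split/= -mulr_suml.
rewrite big_const_seq count_predT iter_addr addr0 -[D `^ r *+ _]mulr_natl.
have sum1 : \sum_(a <- G) (a == a0)%:R <= 1 :> R.
  rewrite -natr_sum (eq_bigr (fun a => if a == a0 then 1%N else 0%N)); last first.
    by move=> a _; case: eqP.
  rewrite -big_mkcond sum1_count count_uniq_mem// -[leRHS]/(1%:R) ler_nat.
  exact: leq_b1.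
have W0 : 0 <= 2 `^ r * (D `^ r + rho `^ r) by rewrite mulr_ge0 ?addr_ge0 ?powR_ge0.
have := ler_wpM2r W0 sum1; lra.
Qed.

End distortion_theory.

(** * The gap between consecutive optimal distortions *)

Section crowded_points.
Context {R : realType} {d : nat}.
Context (d_gt0 : (0 < d)%N).
Implicit Types (s : seq 'rV[R]_d) (rho : R).

Definition crowded s rho : seq 'rV[R]_d :=
  [seq a <- s | has (fun b => (b != a) && (`|a - b| <= rho)) s].

(** Write c for (2 * u)^d.  The cubes of radius [u] around the points of [s] near [E]
    cover [E], so there are at least delta / c such points.  Those that are not
    crowded at scale 2 * L * u are centres of disjoint cubes of radius L * u in a
    fixed cube; their number is at most V / (L^d * c), where V is the volume of that
    cube, and this is at most half of delta / c as soon as [L] is large. *)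
Lemma crowded_count s (E : set (borel_rV R d)) (K delta L u : R) :
  uniq s -> measurable E -> 0 <= K -> 0 < u -> 1 <= L -> L * u <= 1 ->
  (2 * (K + 2)) ^+ d <= L * (delta / 2) ->
  (forall x, E x -> `|x : 'rV[R]_d| <= K) ->
  (forall x, E x -> exists2 a, a \in s & `|x - a| <= u) ->
  (delta%:E <= lebesgue_rV d E)%E ->
  delta / 2 <= (size (crowded s (2 * (L * u))))%:R * (2 * u) ^+ d.
Proof.
move=> us mE K0 u0 L1 Lu KL EK Es dE.
have L0 : 0 < L by exact: lt_le_trans L1.
have uLu : u <= L * u by rewrite ler_peMl// ltW.
pose p (a : 'rV[R]_d) : bool := has (fun b => (b != a) && (`|a - b| <= 2 * (L * u))) s.
pose s0 : seq 'rV[R]_d := [seq a <- s | `|a| <= K + u].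
have us0 : uniq s0 by exact: filter_uniq.
have hcov : delta <= (size s0)%:R * (2 * u) ^+ d.
  rewrite -lee_fin (le_trans dE)//; apply: lebesgue_rV_cover => //; first exact: ltW.
  move=> x Ex; have [a as_ xa] := Es _ Ex; exists a => //.
  rewrite mem_filter as_ andbT -(subrK x a) addrC (le_trans (ler_normD _ _))//.
  by rewrite lerD ?EK// distrC.
have hpack : (size [seq a <- s0 | predC p a])%:R * (2 * (L * u)) ^+ d <=
    (2 * (K + u + L * u)) ^+ d.
  apply: (lebesgue_rV_packing (s := [seq a <- s0 | predC p a])).
  - by rewrite mulr_ge0// ltW.
  - by rewrite addr_ge0// ltW.
  - exact: filter_uniq.
  - move=> a b; rewrite !mem_filter => /andP[/= /hasPn pa _] /and3P[_ _ bs] ab.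
    by have := pa _ bs; rewrite eq_sym ab/= -ltNge.
  - by move=> a; rewrite !mem_filter => /and3P[].
have U0 : 0 <= (2 * u) ^+ d by rewrite exprn_ge0// mulr_ge0// ltW.
have hI : (size [seq a <- s0 | predC p a])%:R * (2 * u) ^+ d <= delta / 2.
  rewrite -(ler_pM2l L0) (le_trans _ KL)//.
  rewrite (@le_trans _ _ ((2 * (K + u + L * u)) ^+ d))//; last first.
    rewrite lerXn2r ?nnegrE//; [|lra..].
    by rewrite mulr_ge0// !addr_ge0 ?mulr_ge0// ltW.
  rewrite (le_trans _ hpack)// mulrCA ler_wpM2l//.
  rewrite (mulrCA 2) [leRHS]exprMn ler_wpM2r//.
  by rewrite -[leLHS]expr1 ler_weXn2l.
have hC : ((size [seq a <- s0 | p a])%:R <= (size (crowded s (2 * (L * u))))%:R :> R).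
  rewrite ler_nat (_ : [seq a <- s0 | p a] =
      [seq a <- crowded s (2 * (L * u)) | `|a| <= K + u]).
    by rewrite size_filter count_size.
  by rewrite -!filter_predI; apply: eq_filter => a /=; rewrite andbC.
have hsz : (size s0)%:R =
    (size [seq a <- s0 | p a])%:R + (size [seq a <- s0 | predC p a])%:R :> R.
  by rewrite -natrD -(count_predC p s0) -!size_filter.
move: hcov; rewrite hsz mulrDl => hcov.
have := ler_wpM2r U0 hC; lra.
Qed.

End crowded_points.

Section increments.
Context {R : realType} {d : nat} {N : 'rV[R]_d -> R}.
Context (d_gt0 : (0 < d)%N) (N_norm : is_norm N).
Context (P : probability (borel_rV R d) R).
Context (Pa : {measure set (borel_rV R d) -> \bar R}).
Context (PaP : forall A, measurable A -> (Pa A <= P A)%E)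
  (Pa_ac : Pa `<< lebesgue_rV d).

Let Pa_finite : fin_num_fun Pa.
Proof.
move=> A mA; rewrite ge0_fin_numE// (le_lt_trans (PaP mA))//.
by rewrite (le_lt_trans (probability_le1 P mA))// ltry.
Qed.

(** The part of a large ball that remains after removing a set of small probability
    keeps a fixed amount of Lebesgue measure: it keeps at least half of the mass
    that [Pa] gives to the ball. *)
Lemma absolutely_continuous_part_spread (B : set (borel_rV R d)) :
  measurable B -> (0 < Pa B)%E ->
  exists K m delta : R, [/\ 0 <= K, 0 < m, 0 < delta &
   forall F, measurable F -> (P F <= m%:E)%E ->
   (delta%:E <= lebesgue_rV d
     (norm_ball (fun x : 'rV[R]_d => `|x|)%R 0%R K `\` F)%classic)%E].
Proof.
move=> mB PaB.
pose S (k : nat) : set (borel_rV R d) := norm_ball (fun x : 'rV[R]_d => `|x|) 0 k%:R.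
have mS k : measurable (S k) by exact: measurable_cube.
have [k Sk] : exists k, (0 < Pa (S k))%E.
  apply: contrapT => /forallNP S0; move: PaB; rewrite lt0e measure_ge0 andbT => /eqP; apply.
  apply: (@subset_measure0 _ _ _ Pa _ (\bigcup_k S k)) => //.
  - exact: bigcup_measurable.
  - move=> x _; exists (Num.bound `|x : 'rV[R]_d|) => //.
    by rewrite /S /norm_ball/= subr0 ltW// archi_boundP.
  - apply/negligibleP; first exact: bigcup_measurable.
    apply: negligible_bigcup => i; apply/negligibleP => //.
    by apply/eqP; have /negP := S0 i; rewrite lt0e measure_ge0 andbT negbK.
have mf : Pa (S k) \is a fin_num by exact: Pa_finite.
set m := fine (Pa (S k)).
have m0 : 0 < m by rewrite fine_gt0// Sk ltey_eq mf.
have mE : Pa (S k) = m%:E by rewrite fineK.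
have Pa_lty : (Pa setT < +oo)%E by rewrite ltey_eq Pa_finite.
(* the restriction of Pa to the whole space is Pa, packaged as a finite measure *)
pose nu := mfrestr measurableT Pa_lty.
have nuE A : nu A = Pa A by rewrite /nu /mfrestr /mrestr setIT.
have nu_ac : nu `<< lebesgue_rV d.
  apply/null_content_dominatesP => A mA A0; rewrite nuE.
  by move/null_content_dominatesP : Pa_ac; exact.
have [delta delta0 hd] := finite_measure_abs_continuous nu_ac (divr_gt0 m0 (ltr0n _ 2)).
have Pa_small F :
    measurable F -> (lebesgue_rV d F < delta%:E)%E -> (Pa F < (m / 2)%:E)%E.
  by move=> mF /(hd _ mF); rewrite -nuE.
exists k%:R, (m / 2), delta; split=> //; first exact: divr_gt0.
move=> F mF PF; rewrite leNgt; apply/negP => /Pa_small.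
have mSF : measurable (S k `\` F) by exact: measurableD.
move=> /(_ mSF); rewrite ltNge => /negP; apply.
have : (Pa (S k) <= Pa (S k `\` F) + (m / 2)%:E)%E.
  apply: (@le_trans _ _ (Pa ((S k `\` F) `|` F))).
    apply: le_measure; rewrite ?inE//; first exact: measurableU.
    by move=> x Sx; have [Fx|Fx] := pselect (F x); [right|left].
  apply: (le_trans (measureU2 _ _ _)) => //.
  by rewrite leeD2l// (le_trans (PaP mF)).
rewrite mE -[Pa (S k `\` F)]fineK ?Pa_finite// -EFinD !lee_fin; lra.
Qed.

(** Since [mesh d n ^+ d] is the inverse of [n], the bound is of order n^(-1-r/d), the
    gap of a sequence that decreases regularly like n^(-r/d).  Nothing says that the
    gaps are monotone, so the rate of decrease alone does not yield it. *)
Lemma distortion_increment r (E0 : R) : 0 < r -> 0 < E0 ->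
  (exists2 B, measurable B & (0 < Pa B)%E) ->
  (forall n A, (0 < n)%N -> optimal_quantizer N P r n A ->
    (distortion N P r A <= (E0 * mesh d n `^ r)%:E)%E) ->
  exists2 D : R, 0 < D & forall n A B, (0 < n)%N ->
    optimal_quantizer N P r n A -> optimal_quantizer N P r n.+1 B ->
    (distortion N P r A <= distortion N P r B + (D * (mesh d n `^ r / n%:R))%:E)%E.
Proof.
move=> r0 E00 [Bm mBm PaBm] rate.
have [C1 C10 NC] := is_norm_le_mx N_norm; have [C2 C20 CN] := mx_le_is_norm N_norm.
have [K [m [delta [K0 m0 delta0 spread]]]] := absolutely_continuous_part_spread mBm PaBm.
(* with this tau, Markov's inequality bounds P(d >= tau * h) by m *)
pose tau := (E0 / m) `^ r^-1.
have tau0 : 0 < tau by rewrite powR_gt0// divr_gt0.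
have taur : tau `^ r = E0 / m.
  by rewrite /tau -powRrM mulVf ?gt_eqF// powRr1// divr_ge0// ltW.
pose U := C2 * tau; have U0 : 0 < U by rewrite mulr_gt0.
pose V := (2 * (K + 2)) ^+ d.
have V0 : 0 < V by rewrite exprn_gt0//; lra.
pose L := 1 + V / (delta / 2).
have dd0 : 0 < delta / 2 by rewrite divr_gt0.
have L1 : 1 <= L by rewrite lerDl divr_ge0// ltW.
have L0 : 0 < L by exact: lt_le_trans L1.
have VL : V <= L * (delta / 2).
  by rewrite /L mulrDl mul1r divfK ?gt_eqF// lerDr ltW.
(* at least g * n points of B are crowded, in the norm N, at scale rho0 * h *)
pose g := (delta / 2) / (2 * U) ^+ d.
have UU0 : 0 < (2 * U) ^+ d by rewrite exprn_gt0// mulr_gt0.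
have g0 : 0 < g by rewrite divr_gt0.
pose rho0 := C1 * (2 * (L * U)).
have rho00 : 0 < rho0 by rewrite !mulr_gt0.
(* W * h^r bounds the error term of the removal inequality *)
pose W := 2 `^ r * (E0 + rho0 `^ r).
have W0 : 0 < W by rewrite mulr_gt0 ?powR_gt0// addr_gt0// powR_gt0.
have LU0 : 0 < (L * U) ^+ d by rewrite exprn_gt0// mulr_gt0.
exists (W / g + E0 * (L * U) ^+ d).
  by rewrite addr_gt0 ?divr_gt0// mulr_gt0.
move=> n A B n0 oA oB.
have nR : 0 < n%:R :> R by rewrite ltr0n.
have h0 := mesh_gt0 (R := R) d n0; have hd := mesh_expn (R := R) d_gt0 n.
have := rate n A n0 oA; set h := mesh d n in h0 hd *.
have hr0 : 0 < h `^ r by exact: powR_gt0.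
case: oA => A0 cA optA; case: oB => B0 cB optB.
have eBA : (distortion N P r B <= distortion N P r A)%E.
  by apply: optB => //; apply: card_le_trans cA _; rewrite card_le_II.
have [s [us ss Bs]] := seq_card_le cB.
move=> rateA.
have fA : distortion N P r A \is a fin_num.
  by rewrite ge0_fin_numE ?distortion_ge0// (le_lt_trans rateA)// ltry.
have fB : distortion N P r B \is a fin_num.
  by rewrite ge0_fin_numE ?distortion_ge0// (le_lt_trans eBA)// (le_lt_trans rateA)// ltry.
have B_ge0 := distortion_ge0 (N := N) P B r.
have [a aE] : exists a, distortion N P r A = a%:E.
  by eexists; exact: esym (fineK fA).
have [e eE] : exists e, distortion N P r B = e%:E.
  by eexists; exact: esym (fineK fB).
rewrite aE eE -EFinD lee_fin.
move: (rateA) (eBA) (B_ge0); rewrite aE eE !lee_fin => aE0 ea e0.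
rewrite mulrDl.
(* for the finitely many n with L * U * h > 1, the distortion of A alone is below
   the bound *)
have [Lu|Lu] := leP (L * (U * h)) 1; last first.
  have : 1 <= (L * U) ^+ d * n%:R^-1.
    by rewrite -hd -exprMn exprn_ege1// -mulrA ltW.
  rewrite -(ler_pM2l (mulr_gt0 E00 hr0)) mulr1 => h1.
  rewrite (le_trans (le_trans aE0 h1))// addrA.
  have -> : E0 * (L * U) ^+ d * (h `^ r / n%:R) = E0 * h `^ r * ((L * U) ^+ d / n%:R) by ring.
  by rewrite lerDr addr_ge0// mulr_ge0// ?divr_ge0// ltW.
have u0 : 0 < U * h by exact: mulr_gt0.
pose F : set (borel_rV R d) := setT `&` [set x : borel_rV R d |
  ((tau * h) `^ r)%:E <= `|(norm_dist N x B `^ r)%:E| ]%E.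
have th0 : 0 < (tau * h) `^ r by rewrite powR_gt0// mulr_gt0.
have mB := measurable_norm_dist_powR N_norm r B0.
have mF : measurable F.
  by apply: emeasurable_fun_c_infty => //; exact: measurableT_comp.
have PF : (P F <= m%:E)%E.
  have [p pE] : exists p, P F = p%:E by eexists; exact: esym (fineK (fin_num_measure P _ mF)).
  have : (((tau * h) `^ r)%:E * P F <= distortion N P r B)%E.
    apply: le_trans (le_integral_abse P measurableT mB th0) _.
    rewrite le_eqVlt; apply/orP; left; apply/eqP; apply: eq_integral => x _.
    by rewrite gee0_abs// lee_fin powR_ge0.
  rewrite eE pE -EFinM !lee_fin => PFe.
  rewrite -(ler_pM2l th0) (le_trans PFe)// (le_trans ea)// (le_trans aE0)//.
  by rewrite (powRM _ (ltW tau0) (ltW h0)) taur mulrAC divfK ?gt_eqF.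
have dE := spread F mF PF.
set E := (_ `\` F)%classic in dE.
have mE : measurable (E : set (borel_rV R d)).
  by apply: measurableD => //; exact: measurable_cube.
have EK (x : borel_rV R d) : E x -> `|x : 'rV[R]_d| <= K.
  by case; rewrite /norm_ball/= subr0.
have Es (x : borel_rV R d) : E x -> exists2 c, c \in s & `|x - c : 'rV[R]_d| <= U * h.
  move=> [_ nF].
  have [c Bc xc] : exists2 c, B c & norm_dist N x B = N (x - c).
    by apply: norm_dist_attained => //; rewrite Bs; exact: finite_seq.
  exists c; first by move: Bc; rewrite Bs.
  rewrite (le_trans (CN _))// /U -mulrA ler_pM2l// -xc leNgt; apply/negP => lt.
  apply: nF; split=> //=; rewrite lee_fin ger0_norm ?powR_ge0//.
  by apply: powR_mono; [exact: ltW|rewrite mulr_ge0// ltW|exact: ltW].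
have := crowded_count d_gt0 us mE K0 u0 L1 Lu VL EK Es dE.
set G := crowded s _ => hG.
have gn : g * n%:R <= (size G)%:R.
  rewrite /g mulrAC ler_pdivrMr//.
  by move: hG; rewrite [2 * (U * h)]mulrA exprMn hd mulrA ler_pdivlMr.
pose rho := C1 * (2 * (L * (U * h))).
have Gs : {in G, forall a, a \in s /\ exists b, [/\ b \in s, b != a & N (a - b) <= rho]}.
  move=> c; rewrite mem_filter => /andP[/hasP[b bs /andP[bc cb]] cs]; split=> //.
  by exists b; split=> //; rewrite (le_trans (NC _))// ler_pM2l.
have Gv : {in G, forall a, (distortion N P r A <= distortion N P r [set` rem a s])%E}.
  move=> c /Gs[cs [b [bs bc _]]]; apply: optA.
    by exists b; rewrite /= mem_rem_uniq// inE bc.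
  by apply: card_le_seq; rewrite size_rem//; case: (size s) ss.
have rho_ge0 : 0 <= rho by rewrite /rho !mulr_ge0// ltW.
have key : (size G)%:R * a <= (size G)%:R * e + 2 `^ r * (e + rho `^ r).
  rewrite -lee_fin EFinD !EFinM EFinD -aE -eE Bs.
  exact: (distortion_remove_points N_norm r0 rho_ge0 us (filter_uniq _ us) Gs Gv).
have rhor : rho `^ r = rho0 `^ r * h `^ r.
  by rewrite -powRM ?ltW//; congr (_ `^ _); rewrite /rho /rho0; ring.
have key2 : (size G)%:R * (a - e) <= W * h `^ r.
  rewrite mulrBr lerBlDl (le_trans key)// lerD2l /W -mulrA ler_wpM2l ?powR_ge0//.
  by rewrite rhor mulrDl lerD2r (le_trans ea).
have key3 : g * n%:R * (a - e) <= W * h `^ r.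
  by rewrite (le_trans _ key2)// ler_wpM2r// subr_ge0.
have : a - e <= W / g * (h `^ r / n%:R).
  rewrite (_ : W / g * _ = W * h `^ r / (g * n%:R)); last first.
    by rewrite [(g * _)^-1]invfM; ring.
  by rewrite (ler_pdivlMr _ _ (mulr_gt0 g0 nR)) mulrC.
rewrite lerBlDl => /le_trans; apply; rewrite lerD2l lerDl.
by apply: ltW; rewrite mulr_gt0 ?divr_gt0// mulr_gt0.
Qed.

End increments.

(** * The maximal function controls the distance *)

Section maximal_function_theory.
Context {R : realType} {d : nat} {N : 'rV[R]_d -> R}.
Context (N_norm : is_norm N).

Lemma lebesgue_rV_norm_ball_ge : exists2 c : R, 0 < c &
  forall y rho, 0 <= rho -> ((c * rho ^+ d)%:E <= lebesgue_rV d (norm_ball N y rho))%E.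
Proof.
have [C C0 NC] := is_norm_le_mx N_norm.
exists ((2 / C) ^+ d); first by rewrite exprn_gt0// divr_gt0.
move=> y rho rho0; rewrite -exprMn -mulrA (mulrC C^-1).
rewrite -(lebesgue_rV_cube y) ?divr_ge0 ?(ltW C0)//.
apply: le_measure; rewrite ?inE; [exact: measurable_cube|exact: measurable_norm_ball|].
by move=> x; rewrite /norm_ball/= ler_pdivlMr// mulrC; apply: le_trans.
Qed.

Lemma maximal_function_ge0 (P : probability (borel_rV R d) R)
    (alpha : nat -> set 'rV[R]_d) (b : R) y : (0 <= maximal_function N P alpha b y)%E.
Proof.
apply: (@le_trans _ _ (lebesgue_rV d (norm_ball N y (b * norm_dist N y (alpha 1%N))) /
    P (norm_ball N y (b * norm_dist N y (alpha 1%N))))%E).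
  by rewrite mule_ge0 ?inve_ge0.
by apply: ereal_sup_ubound; exists 1%N.
Qed.

(** [v] is any positive bound on the gap, rather than the gap itself: when the ball of
    centre [y] has probability 0 the maximal function is infinite, and the bound
    would fail for a null gap, as +oo * 0 = 0. *)
Lemma norm_dist_le_maximal_function (P : probability (borel_rV R d) R)
    (alpha : nat -> set 'rV[R]_d) (r b : R) : 0 < r -> 0 < b < 1 / 2 ->
  exists2 c : R, 0 < c & forall n (v : R) y, (0 < n)%N -> 0 < v ->
    alpha n !=set0 -> distortion N P r (alpha n) \is a fin_num ->
    (distortion N P r (alpha n) <= distortion N P r (y |` alpha n) + v%:E)%E ->
    ((norm_dist N y (alpha n) `^ (d%:R + r))%:E <=
     maximal_function N P alpha b y * (c * v)%:E)%E.
Proof.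
move=> r0 /andP[b0 b12]; have [c1 c10 hc1] := lebesgue_rV_norm_ball_ge.
pose k := (1 - b) `^ r - b `^ r.
have k0 : 0 < k.
  rewrite subr_gt0; apply: gt0_ltr_powR => //; rewrite ?nnegrE; lra.
have bd0 : 0 < b ^+ d by exact: exprn_gt0.
have K0 : 0 < k * (c1 * b ^+ d) by rewrite !mulr_gt0.
exists (k * (c1 * b ^+ d))^-1; first by rewrite invr_gt0.
move=> n v y n0 v0 A0 fA gap; set w := _ * v.
have w0 : 0 < w by rewrite mulr_gt0// invr_gt0.
set A := alpha n in A0 fA gap *.
set D := norm_dist N y A; have D0 : 0 <= D by exact: norm_dist_ge0.
pose Bl := norm_ball N y (b * D).
have ratio_le : (lebesgue_rV d Bl / P Bl <= maximal_function N P alpha b y)%E.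
  by apply: ereal_sup_ubound; exists n.
have [D00|Dn0] := eqVneq D 0.
  rewrite D00 powR0; last by rewrite gt_eqF// ltr_wpDl.
  by rewrite mule_ge0 ?lee_fin ?(ltW w0)// maximal_function_ge0.
have {Dn0}Dp : 0 < D by rewrite lt_neqAle eq_sym Dn0.
have mBl : measurable (Bl : set (borel_rV R d)) by exact: measurable_norm_ball.
have lam : ((c1 * (b * D) ^+ d)%:E <= lebesgue_rV d Bl)%E.
  by apply: hc1; rewrite mulr_ge0// ltW.
have lam0 : 0 < c1 * (b * D) ^+ d by rewrite mulr_gt0// exprn_gt0// mulr_gt0.
have [p pE] : exists p, P Bl = p%:E.
  by eexists; exact: esym (fineK (fin_num_measure P _ mBl)).
have p0 : 0 <= p by rewrite -lee_fin -pE.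
have gap' : k * D `^ r * p <= v.
  have b01 : 0 <= b <= 1 by lra.
  have := distortion_add_point N_norm P y r0 A0 b01; rewrite -/D -/Bl -/k pE => h1.
  have fy : distortion N P r (y |` A) \is a fin_num.
    rewrite ge0_fin_numE; last exact: distortion_ge0.
    apply: (@le_lt_trans _ _ (distortion N P r A)); last by rewrite ltey_eq fA.
    by apply: le_trans h1; rewrite leeDl// lee_fin mulr_ge0// mulr_ge0 ?powR_ge0// ltW.
  by move: (le_trans h1 gap); rewrite leeD2lE// -EFinM lee_fin.
have DE : D `^ (d%:R + r) = D ^+ d * D `^ r.
  by rewrite powRD ?powR_mulrn// (gt_eqF Dp) implybT.
have [p00|pn0] := eqVneq p 0.
  suff -> : maximal_function N P alpha b y = +oo%E by rewrite gt0_mulye ?leey.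
  apply/eqP; rewrite -leye_eq (le_trans _ ratio_le)// pE p00.
  by rewrite inve0 gt0_muley// (lt_le_trans _ lam).
have {pn0}pp : 0 < p by rewrite lt_neqAle eq_sym pn0.
apply: (@le_trans _ _ ((c1 * (b * D) ^+ d)%:E / p%:E * w%:E)%E); last first.
  rewrite lee_wpmul2r ?lee_fin ?(ltW w0)// (le_trans _ ratio_le)// pE.
  by rewrite lee_wpmul2r// inve_ge0.
rewrite inver (gt_eqF pp) -!EFinM lee_fin DE.
rewrite [leRHS]mulrAC ler_pdivlMr// /w mulrCA ler_pdivlMl// exprMn.
have -> : k * (c1 * b ^+ d) * (D ^+ d * D `^ r * p) =
  c1 * (b ^+ d * D ^+ d) * (k * D `^ r * p) by ring.
by rewrite ler_wpM2l// -exprMn ltW.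
Qed.

End maximal_function_theory.

Theorem theorem2 (R : realType) (d : nat) (d_gt0 : (1 <= d)%N)
    (N : 'rV[R]_d -> R) (N_norm : is_norm N)
    (r s : R) (r_gt0 : 0 < r) (s_gt0 : 0 < s) (r_lt_s : r < s)
    (P : probability (borel_rV R d) R)
    (Pa Ps : {measure set (borel_rV R d) -> \bar R})
    (P_decomp : lebesgue_decomposition P (lebesgue_rV d) Pa Ps)
    (Pa_neq0 : exists2 A, measurable A & Pa A <> 0%E)
    (P_moment : exists2 eta : R, 0 < eta &
      (\int[P]_x (N x `^ (r + eta))%:E < +oo)%E)
    (alpha : nat -> set 'rV[R]_d)
    (alpha_opt : forall n, (1 <= n)%N -> optimal_quantizer N P r n (alpha n))
    (psi_L1 : exists2 b : R, 0 < b < 1 / 2 &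
      P.-integrable [set: borel_rV R d]
        (fun x => poweR (maximal_function N P alpha b x) (s / (d%:R + r)))) :
  (ereal_sup [set (n%:R `^ (s / d%:R))%:E * distortion N P s (alpha n)
             | n in [set n | (1 <= n)%N]] < +oo)%E.
Proof.
have [PE Pa_ac _] := P_decomp.
have PaP A : measurable A -> (Pa A <= P A)%E by move=> mA; rewrite PE// leeDl.
have Pa_pos : exists2 A, measurable A & (0 < Pa A)%E.
  by have [A mA /eqP PA] := Pa_neq0; exists A => //; rewrite lt0e PA measure_ge0.
have [eta eta0 moment] := P_moment.
have [E E0 rate] := distortion_rate N_norm r_gt0 eta0 d_gt0 moment.
have [D D0 incr] := distortion_increment d_gt0 N_norm PaP Pa_ac r_gt0 E0 Pa_pos rate.
have [b b12 psi_int] := psi_L1.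
have [c c0 point] := norm_dist_le_maximal_function N_norm P alpha r_gt0 b12.
pose q := s / (d%:R + r).
have dr0 : 0 < d%:R + r by rewrite ltr_wpDl.
have q0 : 0 < q by rewrite divr_gt0.
set psi := maximal_function N P alpha b in psi_int point.
have [mpsi psi_fin] := integrableP _ _ _ psi_int.
set J := (\int[P]_x _)%E in psi_fin.
have J0 : (0 <= J)%E by exact: integral_ge0.
pose M := (c * D) `^ q * fine J.
suff bound n : (1 <= n)%N -> ((n%:R `^ (s / d%:R))%:E * distortion N P s (alpha n) <= M%:E)%E.
  apply: (@le_lt_trans _ _ M%:E); last exact: ltry.
  by apply: ge_ereal_sup => _ [n /= n1 <-]; exact: bound.
move=> n1.
have [A0 cA optA] := alpha_opt _ n1.
have nR : 0 < n%:R :> R by rewrite ltr0n.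
have h0 := mesh_gt0 (R := R) d n1; have hd := mesh_expn (R := R) d_gt0 n.
have := incr n _ _ n1 (alpha_opt _ n1) (alpha_opt _ (ltn0Sn n)).
have := rate n _ n1 (alpha_opt _ n1).
have nh : n%:R `^ (s / d%:R) * mesh d n `^ s = 1.
  by rewrite /mesh -powRrM mulNr powRN (mulrC _ s) mulfV// gt_eqF// powR_gt0.
set h := mesh d n in h0 hd nh * => rn inc.
pose v := D * (h `^ r / n%:R).
have hr0 : 0 < h `^ r by exact: powR_gt0.
have v0 : 0 < v by rewrite mulr_gt0// divr_gt0.
have fA : distortion N P r (alpha n) \is a fin_num.
  rewrite ge0_fin_numE; last exact: distortion_ge0.
  exact: le_lt_trans rn (ltry _).
have vE : v = D * h `^ (d%:R + r).
  by rewrite /v powRD ?(gt_eqF h0) ?implybT// powR_mulrn ?(ltW h0)// hd (mulrC (h `^ r)).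
have pt y : ((norm_dist N y (alpha n) `^ s)%:E <=
    ((c * D) `^ q * h `^ s)%:E * `|poweR (psi y) q|)%E.
  have gap : (distortion N P r (alpha n) <= distortion N P r (y |` alpha n) + v%:E)%E.
    have [_ _ optn1] := alpha_opt _ (ltn0Sn n).
    apply: (le_trans inc); apply: leeD2r; apply: optn1; first by exists y; left.
    have [t [_ tn ->]] := seq_card_le cA.
    rewrite (_ : y |` _ = [set` y :: t]); first exact: card_le_seq.
    apply/seteqP; split=> z /=; rewrite inE.
      by move=> [->|->]; rewrite ?eqxx ?orbT.
    by move=> /orP[/eqP|]; [left|right].
  have psi0 : (0 <= psi y)%E by exact: maximal_function_ge0.
  have := point n v y n1 v0 A0 fA gap; rewrite vE mulrA => le1.
  have cDh0 : 0 <= c * D * h `^ (d%:R + r) by rewrite !mulr_ge0 ?powR_ge0// ltW.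
  have : (poweR (norm_dist N y (alpha n) `^ (d%:R + r))%:E q <=
          poweR (psi y * (c * D * h `^ (d%:R + r))%:E) q)%E.
    apply: gt0_ler_poweR; [exact: ltW| | |exact: le1].
      by rewrite in_itv/= lee_fin powR_ge0 leey.
    by rewrite in_itv/= leey andbT mule_ge0.
  have qE : (d%:R + r) * q = s by rewrite /q mulrCA mulfV ?mulr1// gt_eqF.
  rewrite poweRM ?lee_fin// !poweR_EFin -powRrM qE.
  rewrite (powRM _ (ltW (mulr_gt0 c0 D0)) (powR_ge0 _ _)) -powRrM qE.
  by rewrite (gee0_abs (poweR_ge0 _ _)) muleC.
have dist_le : (distortion N P s (alpha n) <= ((c * D) `^ q * h `^ s)%:E * J)%E.
  rewrite /J -ge0_integralZl_EFin//; last 2 first.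
  - exact: measurableT_comp.
  - by rewrite mulr_ge0 ?powR_ge0.
  apply: ge0_le_integral => //.
  - by move=> x _; rewrite lee_fin powR_ge0.
  - exact: measurable_norm_dist_powR.
  - by apply: measurable_funeM; exact: measurableT_comp.
have [j jE] : exists j, J = j%:E by eexists; apply: esym (fineK _); rewrite ge0_fin_numE.
apply: (@le_trans _ _ ((n%:R `^ (s / d%:R))%:E * (((c * D) `^ q * h `^ s)%:E * J))%E).
  by rewrite lee_wpmul2l ?lee_fin ?powR_ge0.
rewrite /M jE /= -!EFinM lee_fin.
have -> : n%:R `^ (s / d%:R) * ((c * D) `^ q * h `^ s * j) =
  n%:R `^ (s / d%:R) * h `^ s * ((c * D) `^ q * j) by ring.
by rewrite nh mul1r.
Qed.
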